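(* Let $M=(m_{nk})_{n,k\in\mathbb N}$ be an infinite matrix with complex entries and no vanishing columns (i.e. for every $k\in\mathbb N$ there is $n\in\mathbb N$ with $m_{nk}\neq 0$). Then $(\ell^p_M,\|\cdot\|_{M,p})$ is a separable Banach space for all $p\geq 1$.
   Context: For an infinite matrix $M=(m_{nk})_{n,k\in\mathbb N}$ with complex entries, $p\ge 1$ and a sequence $x=(x_k)\in\mathbb C^{\mathbb N}$, set $\|x\|_{M,p}=\Big(\sum_{n=1}^{\infty}\Big(\sum_{k=1}^{\infty}|m_{nk}|\,|x_k|\Big)^p\Big)^{1/p}\in[0,\infty]$ and $\ell^p_M=\{x\in\mathbb C^{\mathbb N}:\|x\|_{M,p}<\infty\}$. *)

(* Defs.v *)
From HB Require Import structures.
From mathcomp Require Import all_boot all_order all_algebra.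
From mathcomp Require Import complex.
From mathcomp Require Import all_classical all_reals all_analysis.

Set Implicit Arguments.
Unset Strict Implicit.
Unset Printing Implicit Defensive.

Import Order.TTheory GRing.Theory Num.Theory.
Import numFieldNormedType.Exports.

Local Open Scope classical_set_scope.
Local Open Scope ring_scope.
Local Open Scope complex_scope.
Local Open Scope ereal_scope.

(* Complex sequences, as a vector space over [R[i]]; [^o] selects the regular
   module structure of [R[i]] over itself. *)
Notation Cseq R := (nat -> (R[i]%type)^o).

(* The norm of an [R[i]]-normed module takes its values in [R[i]] (they are
   nonnegative reals there); this is the same norm as an element of [R]. *)
Definition rnorm (R : realType) (E : normedZmodType R[i]) (u : E) : R :=
  complex.Re `|u|%R.

Definition mxp_norm (R : realType) (M : nat -> nat -> R[i]) (p : R)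
    (x : Cseq R) : \bar R :=
  (\sum_(0 <= n <oo)
     (\sum_(0 <= k <oo) (rnorm (M n k) * rnorm (x k))%R%:E) `^ p) `^ p^-1.

Definition ellp_mx (R : realType) (M : nat -> nat -> R[i]) (p : R)
    : set (Cseq R) :=
  [set x | mxp_norm M p x < +oo].

Definition separable (T : topologicalType) : Prop :=
  exists2 D : set T, countable D & dense D.

(* [A] is a linear subspace of [V] on which [N] is finite and is a norm making
   it a separable Banach space: this structure on [A] is presented by a
   complete normed module [E] together with a linear isometry [f] of [E]
   onto [(A, N)]. *)
Definition separable_Banach_space (R : realType) (V : lmodType R[i])
    (A : set V) (N : V -> \bar R) : Prop :=
  exists (E : completeNormedModType R[i]) (f : {linear E -> V}),
    [/\ injective f, range f = A,
        forall u : E, N (f u) = (rnorm u)%:E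
      & separable E].

(* Main.v *)
(* Monotone convergence gives N(x) = sup_K N(x 1_[0,K)) for the norm N of l^p_M.
   Both halves of the theorem rest on truncation. For density of finitely
   supported sequences, superadditivity of t |-> t^p on [0, +oo[ yields
   N(x - x 1_[0,K))^p <= N(x)^p - N(x 1_[0,K))^p, whose right-hand side tends
   to 0. For completeness, |x_k| N(e_k) <= N(x) with N(e_k) > 0 (no vanishing
   column) makes Cauchy filters converge coordinatewise, and the supremum
   formula turns this into convergence in N. A unit sequence e_k may fail to
   be in l^p_M, but then the k-th coordinate vanishes on all of l^p_M. *)
Require Import Defs.
From HB Require Import structures.
From mathcomp Require Import all_boot all_order all_algebra.
From mathcomp Require Import complex.
From mathcomp Require Import all_classical all_reals all_analysis.

Import Order.TTheory GRing.Theory Num.Theory.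
Import numFieldNormedType.Exports.

Local Open Scope classical_set_scope.
Local Open Scope ring_scope.
Local Open Scope complex_scope.
Local Open Scope ereal_scope.

(** * Real-valued norms over the complex numbers *)

Section rnorm_theory.
Context {R : realType}.

Lemma rnormE {E : normedZmodType R[i]} (u : E) : (rnorm u)%:C = `|u|%R.
Proof. by rewrite RRe_real// ger0_real. Qed.

Lemma rnorm_ge0 {E : normedZmodType R[i]} (u : E) : (0 <= rnorm u)%R.
Proof. by rewrite -ler0c rnormE. Qed.

Lemma rnorm0 {E : normedZmodType R[i]} : rnorm (0 : E) = 0%R.
Proof. by apply: complexI; rewrite rnormE normr0. Qed.

Lemma rnorm0_eq0 {E : normedZmodType R[i]} (u : E) : rnorm u = 0%R -> u = 0%R.
Proof. by move=> u0; apply/eqP; rewrite -normr_eq0 -rnormE u0. Qed.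

Lemma rnormD {E : normedZmodType R[i]} (u v : E) :
  (rnorm (u + v) <= rnorm u + rnorm v)%R.
Proof. by rewrite -lecR rmorphD/= !rnormE ler_normD. Qed.

Lemma rnormB {E : normedZmodType R[i]} (u v : E) :
  rnorm (u - v) = rnorm (v - u).
Proof. by apply: complexI; rewrite !rnormE distrC. Qed.

Lemma rnormZ {E : normedModType R[i]} (c : R[i]) (u : E) :
  rnorm (c *: u) = (rnorm c * rnorm u)%R.
Proof. by apply: complexI; rewrite rmorphM/= !rnormE normrZ. Qed.

Lemma rnormM (a b : R[i]) : rnorm (a * b)%R = (rnorm a * rnorm b)%R.
Proof. by apply: complexI; rewrite rmorphM/= !rnormE normrM. Qed.

Lemma rnorm_real (r : R) : rnorm r%:C = `|r|%R.
Proof. by rewrite /rnorm normc_def/= expr0n addr0 sqrtr_sqr. Qed.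

Lemma rnorm_i : rnorm ('i%C : R[i]) = 1%R.
Proof. by rewrite /rnorm normc_def/= expr0n add0r expr1n sqrtr1. Qed.

Lemma ler_normRe (z : R[i]) : (`|complex.Re z| <= rnorm z)%R.
Proof. by rewrite -lecR rnormE normc_ge_Re. Qed.

Lemma ler_normIm (z : R[i]) : (`|complex.Im z| <= rnorm z)%R.
Proof.
rewrite /rnorm normc_def/= -sqrtr_sqr; apply: ler_wsqrtr.
by rewrite lerDr sqr_ge0.
Qed.

Lemma rnorm_leD (z : R[i]) :
  (rnorm z <= `|complex.Re z| + `|complex.Im z|)%R.
Proof.
rewrite {1}[z]complexE (le_trans (@rnormD R[i] _ _))// rnorm_real lerD2l.
by rewrite rnormM rnorm_i mul1r rnorm_real.
Qed.

End rnorm_theory.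

(** * Powers of nonnegative extended reals *)

Section poweR_theory.
Context {R : realType}.

(** Write $t^p = t\,t^{p-1}$ and expand $(a+b)(a+b)^{p-1}$; since $p - 1 \geq 0$, the factor
    $(a+b)^{p-1}$ bounds both $a^{p-1}$ and $b^{p-1}$. *)
Lemma powR_superadditive (a b p : R) : (0 <= a -> 0 <= b -> 1 <= p ->
  a `^ p + b `^ p <= (a + b) `^ p)%R.
Proof.
move=> a0 b0 p1; have p0 : (0 < p)%R by exact: lt_le_trans p1.
rewrite -(mulr_powRB1 a0 p0) -(mulr_powRB1 b0 p0).
rewrite -(mulr_powRB1 (addr_ge0 a0 b0) p0) mulrDl.
rewrite lerD// ler_wpM2l// ge0_ler_powR//.
all: by rewrite ?subr_ge0 ?nnegrE ?addr_ge0// ?lerDl ?lerDr.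
Qed.

Lemma poweR_superadditive (a b : \bar R) (p : R) : 0 <= a -> 0 <= b ->
  (1 <= p)%R -> a `^ p + b `^ p <= (a + b) `^ p.
Proof.
move=> a0 b0 p1.
have p0 : p != 0%R by rewrite gt_eqF// (lt_le_trans _ p1).
case: a a0 => [a||//] a0; last first.
  by rewrite addye ?poweRyr ?leey// gt_eqF// (lt_le_trans _ b0).
case: b b0 => [b||//] b0; last by rewrite addey ?poweRyr ?leey.
by rewrite !poweR_EFin lee_fin powR_superadditive.
Qed.

Lemma le_poweR (p : R) (a b : \bar R) :
  (0 <= p)%R -> 0 <= a -> a <= b -> a `^ p <= b `^ p.
Proof.
move=> p0 a0 ab; apply: gt0_ler_poweR => //; rewrite in_itv/= leey andbT//.
exact: le_trans ab.
Qed.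

Lemma poweRK (p : R) (a : \bar R) :
  p != 0%R -> 0 <= a -> (a `^ p) `^ p^-1 = a.
Proof. by move=> p0 a0; rewrite -poweRrM divff// poweRe1. Qed.

Lemma poweRVK (p : R) (a : \bar R) :
  p != 0%R -> 0 <= a -> (a `^ p^-1) `^ p = a.
Proof. by move=> p0 a0; rewrite -poweRrM mulVf// poweRe1. Qed.

End poweR_theory.

(** [mxp_norm M p x] is the $\ell^p$ norm of the sequence [mxrow M x]. *)
Definition mxrow {R : realType} (M : nat -> nat -> R[i]) (x : Cseq R) (n : nat)
    : \bar R :=
  \sum_(0 <= k <oo) (rnorm (M n k) * rnorm (x k))%:E.

Definition cutoff {R : realType} (K : nat) (x : Cseq R) : Cseq R :=
  fun k => if (k < K)%N then x k else 0%R.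

Definition unitseq {R : realType} (k : nat) : Cseq R :=
  fun j => ((j == k)%:R)%R.

(** * The extended norm on all sequences, and truncation *)

Section mxp_norm_theory.
Context {R : realType} {M : nat -> nat -> R[i]} {p : R} (p1 : (1 <= p)%R).
Implicit Types x y z : Cseq R.
Local Notation N := (mxp_norm M p).

Let p_gt0 : (0 < p)%R. Proof. exact: lt_le_trans p1. Qed.
Let p_ge0 : (0 <= p)%R. Proof. exact: ltW. Qed.
Let p_neq0 : p != 0%R. Proof. by rewrite gt_eqF. Qed.
Local Hint Resolve p_gt0 p_ge0 p_neq0 : core.

Lemma mxterm_ge0 x n k : 0 <= (rnorm (M n k) * rnorm (x k))%:E.
Proof. by rewrite lee_fin mulr_ge0// rnorm_ge0. Qed.
Local Hint Resolve mxterm_ge0 : core.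

Lemma mxrow_ge0 x n : 0 <= mxrow M x n.
Proof. exact: nneseries_ge0. Qed.
Local Hint Resolve mxrow_ge0 : core.

Lemma mxrowD x y n : mxrow M (x + y)%R n <= mxrow M x n + mxrow M y n.
Proof.
rewrite /mxrow -nneseriesD//; apply: lee_nneseries => // k _.
by rewrite -EFinD lee_fin -mulrDr ler_wpM2l ?rnorm_ge0// rnormD.
Qed.

Lemma mxp_norm_ge0 x : 0 <= N x.
Proof. exact: poweR_ge0. Qed.
Local Hint Resolve mxp_norm_ge0 : core.

Lemma mxp_norm_poweR x : N x `^ p = \sum_(0 <= n <oo) mxrow M x n `^ p.
Proof. by rewrite poweRVK// nneseries_ge0// => n _ _; exact: poweR_ge0. Qed.

(** Coordinatewise estimates pass to [N] through this monotonicity, whether or not the norms are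
    finite. *)
Lemma le_mxp_norm x y : (forall k, rnorm (x k) <= rnorm (y k))%R -> N x <= N y.
Proof.
move=> xy; apply: le_poweR; first by rewrite invr_ge0.
  by apply: nneseries_ge0 => n _ _; exact: poweR_ge0.
apply: lee_nneseries => [n _ _|n _]; first exact: poweR_ge0.
apply: le_poweR => //; first exact: mxrow_ge0.
by apply: lee_nneseries => // k _; rewrite lee_fin ler_wpM2l ?rnorm_ge0.
Qed.

Lemma mxp_normZ (c : R[i]) x : N (c *: x)%R = (rnorm c)%:E * N x.
Proof.
have row n : mxrow M (c *: x)%R n = (rnorm c)%:E * mxrow M x n.
  rewrite /mxrow -nneseriesZl//; apply: eq_eseriesr => k _.
  by rewrite -EFinM (@rnormZ _ R[i]^o c (x k)) mulrCA.
rewrite /mxp_norm; under eq_eseriesr => n _.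
  rewrite -/(mxrow M _ n) row poweRM// ?lee_fin ?rnorm_ge0// poweR_EFin.
  over.
rewrite nneseriesZl => [|n _]; last exact: poweR_ge0.
rewrite poweRM ?lee_fin ?powR_ge0//; last first.
  by apply: nneseries_ge0 => n _ _; exact: poweR_ge0.
by rewrite -poweR_EFin poweRK// lee_fin rnorm_ge0.
Qed.

Lemma mxp_norm0 : N 0%R = 0.
Proof. by rewrite -(scale0r (0 : Cseq R)) mxp_normZ rnorm0 mul0e. Qed.

Lemma mxp_normN x : N (- x)%R = N x.
Proof.
by apply/le_anti/andP; split; apply: le_mxp_norm => k; rewrite /rnorm normrN.
Qed.

Lemma mxp_normB x y : N (x - y)%R = N (y - x)%R.
Proof. by rewrite -mxp_normN opprB. Qed.

(** The [p]-th power of one row is a term of the series defining the norm. In particular a finite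
    norm makes all rows finite. *)
Lemma mxrow_le_mxp_norm x n : mxrow M x n <= N x.
Proof.
rewrite -[leLHS](@poweRK _ p)//.
apply: le_poweR; rewrite ?invr_ge0 ?poweR_ge0//.
apply: le_trans (nneseries_lim_ge n.+1 _); last by move=> *; exact: poweR_ge0.
rewrite big_nat_recr//= leeDr//; apply: sume_ge0 => i _; exact: poweR_ge0.
Qed.

(** Minkowski's inequality for the counting measure, applied to the sequences of rows; [mxrowD]
    bounds the rows of the sum. *)
Lemma mxp_normD x y : N (x + y)%R <= N x + N y.
Proof.
have NE z : N z = 'N[counting]_p%:E[mxrow M z].
  rewrite Lnorm_counting//; congr (_ `^ _); apply: eq_eseriesr => n _.
  by rewrite gee0_abs.
(* An infinite norm makes the right-hand side [+oo]; otherwise the rows form real sequences. *)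
have [->|Nx] := eqVneq (N x) +oo.
  by rewrite addye ?leey// gt_eqF// (lt_le_trans _ (mxp_norm_ge0 _)).
have [->|Ny] := eqVneq (N y) +oo.
  by rewrite addey ?leey// gt_eqF// (lt_le_trans _ (mxp_norm_ge0 _)).
have fin z : N z != +oo -> mxrow M z = EFin \o (fine \o mxrow M z).
  rewrite -ltey => Nz; apply/funext => n /=; rewrite fineK// ge0_fin_numE//.
  exact: le_lt_trans (mxrow_le_mxp_norm z n) Nz.
rewrite (NE x) (NE y) (fin _ Nx) (fin _ Ny).
apply: le_trans (eminkowski _ _ _ _) => //.
rewrite Lnorm_counting//; apply: le_poweR; first by rewrite invr_ge0.
  by apply: nneseries_ge0 => n _ _; exact: poweR_ge0.
apply: lee_nneseries => [n _ _|n _]; first exact: poweR_ge0.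
apply: le_poweR => //; first exact: mxrow_ge0.
have -> : (EFin \o ((fine \o mxrow M x) \+ (fine \o mxrow M y))%R) n =
    mxrow M x n + mxrow M y n.
  by rewrite {2}(fin x Nx) {2}(fin y Ny).
by rewrite gee0_abs ?adde_ge0//; exact: mxrowD.
Qed.

(** The sequence $x_k e_k$ is dominated by $x$ in every coordinate. *)
Lemma mxp_norm_coord x k : (rnorm (x k))%:E * N (unitseq k) <= N x.
Proof.
rewrite -mxp_normZ; apply: le_mxp_norm => j.
rewrite (@rnormZ _ R[i]^o (x k) (unitseq k j)) /unitseq; case: eqVneq => [->|_].
  by rewrite /rnorm normr1 mulr1.
by rewrite /= rnorm0 mulr0 rnorm_ge0.
Qed.

(** Row [n] of [unitseq k] contains the positive term $|m_{nk}|$. The norm may still be [+oo]. *)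
Lemma mxp_norm_unitseq_gt0 k : (exists n, M n k <> 0%R) -> 0 < N (unitseq k).
Proof.
move=> [n Mnk]; apply: lt_le_trans (mxrow_le_mxp_norm _ n).
apply: lt_le_trans (nneseries_lim_ge k.+1 _); last by [].
rewrite big_nat_recr//=; apply: lt_le_trans (leeDr _ _); last exact: sume_ge0.
rewrite lte_fin /unitseq eqxx {2}/rnorm normr1 mulr1 lt_neqAle rnorm_ge0 andbT.
by apply/eqP => /esym/rnorm0_eq0.
Qed.

Lemma mxrow_cutoff K x n :
  mxrow M (cutoff K x) n = \sum_(0 <= k < K) (rnorm (M n k) * rnorm (x k))%:E.
Proof.
rewrite /mxrow (nneseries_split 0 K)// add0n [X in _ + X]eseries0 ?adde0.
  by apply: eq_big_nat => k /andP[_ kK]; rewrite /cutoff kK.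
by move=> k Kk _; rewrite /cutoff ltnNge Kk/= rnorm0 mulr0.
Qed.

(** At each coordinate one of the two pieces vanishes, so their rows add up to the row of [x];
    superadditivity of the power is applied row by row. *)
Lemma mxp_norm_cutoff_superadd K x :
  N (x - cutoff K x)%R `^ p + N (cutoff K x) `^ p <= N x `^ p.
Proof.
rewrite !mxp_norm_poweR -nneseriesD => [|n _ _|n _ _]; try exact: poweR_ge0.
apply: lee_nneseries => [n _ _|n _]; first by rewrite adde_ge0 ?poweR_ge0.
apply: le_trans (poweR_superadditive _ _ _ _ _ _) _ => //.
apply: le_poweR => //; rewrite ?adde_ge0// /mxrow -nneseriesD//.
apply: lee_nneseries => [k _ _|k _]; first by rewrite adde_ge0.
rewrite -EFinD -mulrDr lee_fin ler_wpM2l ?rnorm_ge0//.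
rewrite -[(x - _)%R k]/(x k - cutoff K x k)%R /cutoff.
by case: ifP; rewrite ?subrr ?subr0 rnorm0 ?add0r ?addr0.
Qed.

Lemma mxp_norm_cutoff_sup x (C : \bar R) :
  0 <= C -> (forall K, N (cutoff K x) <= C) -> N x <= C.
Proof.
move=> C0 NC; rewrite -[leLHS](@poweRK _ p)// -[leRHS](@poweRK _ p)//.
apply: le_poweR; rewrite ?invr_ge0 ?poweR_ge0// mxp_norm_poweR.
pose g K n := mxrow M (cutoff K x) n `^ p.
have g0 K n : 0 <= g K n by exact: poweR_ge0.
have ndrow n : nondecreasing_seq (fun K => mxrow M (cutoff K x) n).
  move=> a b ab; rewrite !mxrow_cutoff.
  exact: (@ereal_nondecreasing_series _
    (fun k => (rnorm (M n k) * rnorm (x k))%:E) xpredT).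
have ndg n : nondecreasing_seq (g^~ n).
  by move=> a b /ndrow ab; exact: le_poweR.
have L0 n : 0 <= limn (g^~ n).
  apply: lime_ge; first exact: ereal_nondecreasing_is_cvgn.
  by apply: nearW => K; exact: g0.
(* The sum over rows becomes an integral for the counting measure, where monotone convergence in [K]
   applies. *)
rewrite -ge0_integral_count => [|n]; last exact: poweR_ge0.
apply: (@le_trans _ _ (\int[counting]_n limn (g^~ n))).
  apply: ge0_le_integral => // [n _|n _]; first exact: poweR_ge0.
  (* t^p <= L is t <= L^(1/p), so t^p commutes with increasing limits. *)
  rewrite -[leRHS](@poweRVK _ p)//; apply: le_poweR => //.
  apply: lime_le; first exact: is_cvg_nneseries.
  apply: nearW => K; rewrite -mxrow_cutoff -[leLHS](@poweRK _ p)//.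
  apply: le_poweR; rewrite ?invr_ge0 ?poweR_ge0//.
  rewrite (cvg_lim _ (ereal_nondecreasing_cvgn (ndg n)))//.
  by apply: ereal_sup_ubound; exists K.
rewrite monotone_convergence//.
apply: lime_le.
  apply: ereal_nondecreasing_is_cvgn => a b ab.
  by apply: ge0_le_integral => // n _; exact: ndg.
apply: nearW => K; rewrite ge0_integral_count// -mxp_norm_poweR.
exact: le_poweR.
Qed.

(** Lengthening the truncation adds the single term $x_K e_K$; this drives inductions on [K]. *)
Lemma mxp_norm_cutoffS K x :
  N (cutoff K.+1 x) <= N (cutoff K x) + (rnorm (x K))%:E * N (unitseq K).
Proof.
rewrite -mxp_normZ; apply: le_trans (mxp_normD _ _); apply: le_mxp_norm => j.
rewrite -[(cutoff _ _ + _)%R j]/(cutoff K x j + x K * (j == K)%:R)%R.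
rewrite /cutoff ltnS.
by case: (ltngtP j K) => [||->]; rewrite ?mulr0 ?addr0 ?mulr1 ?add0r.
Qed.

Lemma cutoff0 x : cutoff 0 x = 0%R.
Proof. exact/funext. Qed.

(** By contradiction: if all tails had norm at least [e], superadditivity would keep every $N(x
    1_{[0,K)})^p$ below $N(x)^p - e^p$, and so would their supremum $N(x)^p$ be. *)
Lemma mxp_norm_cutoff_approx x (e : R) : (0 < e)%R -> N x < +oo ->
  exists K, N (x - cutoff K x)%R < e%:E.
Proof.
move=> e0 Nx; apply/not_existsP => far.
have eN K : e%:E <= N (x - cutoff K x)%R by rewrite leNgt; apply/negP.
have Nxp : N x `^ p < +oo by exact: poweR_lty.
have Nxf : N x `^ p \is a fin_num by rewrite ge0_fin_numE ?poweR_ge0.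
have bound K : N (cutoff K x) `^ p <= N x `^ p - (e `^ p)%:E.
  rewrite leeBrDr//; apply: le_trans (mxp_norm_cutoff_superadd K x).
  by rewrite addeC leeD2r// -poweR_EFin le_poweR// lee_fin ltW.
have C0 : 0 <= N x `^ p - (e `^ p)%:E.
  by apply: le_trans (bound 0%N); exact: poweR_ge0.
have : N x <= (N x `^ p - (e `^ p)%:E) `^ p^-1.
  apply: mxp_norm_cutoff_sup => [|K]; first exact: poweR_ge0.
  rewrite -[leLHS](@poweRK _ p)//.
  by apply: le_poweR; rewrite ?invr_ge0 ?poweR_ge0.
(* Cancelling the finite $N(x)^p$ leaves $e^p \leq 0$. *)
move=> /(le_poweR _ _ _ p_ge0 (mxp_norm_ge0 x)); rewrite poweRVK//.
by rewrite -(fineK Nxf) lee_fin lerDl oppr_ge0 leNgt powR_gt0.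
Qed.

End mxp_norm_theory.

(* The two proof arguments are phantoms: the canonical structures declared below
   depend on them and must be inferable from the type. *)
Definition ellp_pred {R : realType} {M : nat -> nat -> R[i]} {p : R}
    of (1 <= p)%R & (forall k, exists n, M n k <> 0%R) : {pred Cseq R} :=
  mem (ellp_mx M p).

(** * The normed module structure on $\ell^p_M$ *)

Section ellp_space.
Context {R : realType} {M : nat -> nat -> R[i]} {p : R} (p1 : (1 <= p)%R).
Context (M_col : forall k, exists n, M n k <> 0%R).
Local Notation N := (mxp_norm M p).
Local Notation ellp := (ellp_pred p1 M_col).

Lemma ellp_submod_closed : submod_closed ellp.
Proof.
split=> [|c x y]; rewrite !inE /ellp_mx/= ?mxp_norm0//.
move=> Nx Ny; apply: le_lt_trans (mxp_normD p1 _ _) _ => //.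
rewrite mxp_normZ// lte_add_pinfty// lte_mul_pinfty// lee_fin.
exact: rnorm_ge0.
Qed.

HB.instance Definition _ :=
  GRing.isSubmodClosed.Build _ _ ellp ellp_submod_closed.

Record ellp_type := Ellp { ellp_val :> Cseq R; ellp_valP : ellp_val \in ellp }.

HB.instance Definition _ := [isSub for ellp_val].
HB.instance Definition _ := [Choice of ellp_type by <:].
HB.instance Definition _ := [SubChoice_isSubLmodule of ellp_type by <:].

(** [fine] loses nothing here, because the norm is finite on [ellp_type]. *)
Definition ellp_norm (u : ellp_type) : R := fine (N (val u)).

Lemma ellp_lty (u : ellp_type) : N (val u) < +oo.
Proof. by have := valP u; rewrite inE. Qed.

Lemma ellp_normE (u : ellp_type) : (ellp_norm u)%:E = N (val u).
Proof. by rewrite fineK// ge0_fin_numE ?mxp_norm_ge0// ellp_lty. Qed.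

Lemma ellp_normD (u v : ellp_type) :
  ((ellp_norm (u + v))%:C <= (ellp_norm u)%:C + (ellp_norm v)%:C)%R.
Proof.
by rewrite -rmorphD lecR -lee_fin EFinD !ellp_normE raddfD mxp_normD.
Qed.

Lemma ellp_normZ (c : R[i]) (u : ellp_type) :
  ((ellp_norm (c *: u))%:C = `|c| * (ellp_norm u)%:C)%R.
Proof.
rewrite -rnormE -rmorphM; congr (_%:C); apply: EFin_inj.
by rewrite EFinM !ellp_normE linearZ/= mxp_normZ.
Qed.

(** Definiteness comes from the absence of vanishing columns: $|u_k| N(e_k) \leq 0$ with $N(e_k) >
    0$, possibly infinite, forces $u_k = 0$. *)
Lemma ellp_norm_eq0 (u : ellp_type) :
  (ellp_norm u)%:C%R = 0%R :> R[i] -> u = 0%R.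
Proof.
move=> /complexI u0; apply: val_inj; apply/funext => k /=.
have := mxp_norm_coord (M := M) p1 (val u) k; rewrite -ellp_normE u0.
have := mxp_norm_unitseq_gt0 p1 k (M_col k).
set d := N _ => d0 ud; apply/rnorm0_eq0/eqP.
rewrite eq_le rnorm_ge0 andbT leNgt; apply/negP => uk.
by move: ud; rewrite leNgt mule_gt0.
Qed.

HB.instance Definition _ := Lmodule_isNormed.Build R[i] ellp_type
  ellp_normD ellp_normZ ellp_norm_eq0.

Lemma ellp_rnormE (u : ellp_type) : (rnorm u)%:E = N (val u).
Proof. by rewrite -ellp_normE. Qed.

End ellp_space.

Arguments Ellp {R M p p1 M_col ellp_val}.
Arguments ellp_lty {R M p p1 M_col}.
Arguments ellp_rnormE {R M p p1 M_col}.

(** * Limits of real and complex functions along Cauchy filters *)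

Section cauchy_filters.
Context {R : realType} {T : Type} (F : set_system T) {FF : ProperFilter F}.

Lemma cauchy_near_cvg_real (f : T -> R) :
  (forall e, 0 < e -> exists c, \forall v \near F, `|c - f v| < e)%R ->
  (exists l, forall e, 0 < e -> \forall v \near F, `|l - f v| < e)%R.
Proof.
move=> fF; have : cvg (f @ F).
  apply: cauchy_cvg; apply: cauchy_exP => e e0; have [c cF] := fF e e0.
  by exists c.
by move=> /cvgrPdist_lt fl; exists (lim (f @ F)) => e e0; exact: fl.
Qed.

(** The real and imaginary parts converge separately, and [rnorm_leD] recombines them. *)
Lemma cauchy_near_cvg_complex (f : T -> R[i]) :
  (forall e, 0 < e -> exists c, \forall v \near F, rnorm (c - f v) < e)%R ->
  (exists l, forall e, 0 < e -> \forall v \near F, rnorm (l - f v) < e)%R.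
Proof.
move=> fF.
have [a aF] : (exists l, forall e, 0 < e ->
    \forall v \near F, `|l - complex.Re (f v)| < e)%R.
  apply: cauchy_near_cvg_real => e e0; have [c cF] := fF e e0.
  exists (complex.Re c); apply: filterS cF => v; apply: le_lt_trans.
  by rewrite -raddfB; exact: ler_normRe.
have [b bF] : (exists l, forall e, 0 < e ->
    \forall v \near F, `|l - complex.Im (f v)| < e)%R.
  apply: cauchy_near_cvg_real => e e0; have [c cF] := fF e e0.
  exists (complex.Im c); apply: filterS cF => v; apply: le_lt_trans.
  by rewrite -raddfB; exact: ler_normIm.
exists (a +i* b) => e e0.
have e20 : (0 < e / 2)%R by rewrite divr_gt0.
apply: filterS2 (aF _ e20) (bF _ e20) => v av bv.
rewrite (splitr e) (le_lt_trans (rnorm_leD _))// !raddfB/=.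
exact: ltrD.
Qed.

End cauchy_filters.

(** * Completeness and separability of $\ell^p_M$ *)

Section ellp_complete.
Context {R : realType} {M : nat -> nat -> R[i]} {p : R} {p1 : (1 <= p)%R}.
Context {M_col : forall k, exists n, M n k <> 0%R}.
Local Notation N := (mxp_norm M p).
Local Notation E := (ellp_type p1 M_col).

Lemma ellp_ballE (u v : E) (e : R) :
  ball u e%:C v = (N (val u - val v)%R < e%:E) :> Prop.
Proof.
by rewrite -ball_normE/= -rnormE ltcR -lte_fin ellp_rnormE raddfB.
Qed.

Lemma ellp_cauchy_near {F : set_system E} : ProperFilter F -> cauchy F ->
  forall e : R, (0 < e)%R ->
  exists u : E, \forall v \near F, N (val u - val v)%R < e%:E.
Proof.
move=> FF /cauchyP Fc e e0.
have eC0 : (0 < e%:C :> R[i])%R by rewrite ltcR.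
have [u uF] := Fc _ eC0; exists u.
by apply: filterS uF => v; rewrite ellp_ballE.
Qed.

(** A nonzero coordinate would make $|u_k| N(e_k)$ infinite, while it is bounded by the finite
    $N(u)$. *)
Lemma ellp_coord_eq0 k (u : E) : N (unitseq k) = +oo -> val u k = 0%R.
Proof.
move=> dy.
have := le_lt_trans (mxp_norm_coord (M := M) p1 (val u) k) (ellp_lty u).
rewrite dy => uk; apply/rnorm0_eq0/eqP; rewrite eq_le rnorm_ge0 andbT leNgt.
by apply/negP => uk0; move: uk; rewrite gt0_muley ?lte_fin.
Qed.

(** The weight $N(e_k)$ lets one statement cover both cases: if it is [+oo], the coordinate and [l]
    are 0 and $0 \cdot \infty = 0$. *)
Lemma ellp_cauchy_coord {F : set_system E} k : ProperFilter F -> cauchy F ->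
  exists l : R[i], forall e : R, (0 < e)%R ->
  \forall v \near F, (rnorm (val v k - l))%:E * N (unitseq k) <= e%:E.
Proof.
move=> FF Fc; have d0 := mxp_norm_unitseq_gt0 p1 k (M_col k).
have [dy|] := eqVneq (N (unitseq k)) +oo.
  exists 0%R => e e0; apply: nearW => v.
  by rewrite (ellp_coord_eq0 _ _ dy) subr0 rnorm0 mul0e lee_fin ltW.
rewrite -ltey => dy; move: d0 dy.
case: (N (unitseq k)) (mxp_norm_coord (M := M) p1 ^~ k) => // d coord.
rewrite lte_fin => d0 _.
have [l lF] : (exists l, forall e, 0 < e ->
    \forall v \near F, rnorm (l - val v k) < e)%R.
  apply: cauchy_near_cvg_complex => e e0.
  have [u uF] := ellp_cauchy_near FF Fc _ (mulr_gt0 e0 d0).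
  exists (val u k); apply: filterS uF => v /(le_lt_trans (coord _)).
  by rewrite lte_fin ltr_pM2r.
exists l => e e0; have := lF _ (divr_gt0 e0 d0); apply: filterS => v vl.
by rewrite lee_fin -ler_pdivlMr// rnormB ltW.
Qed.

Lemma ellp_cauchy_cvg (F : set_system E) : ProperFilter F -> cauchy F -> cvg F.
Proof.
move=> FF Fc.
have [y yF] := choice (fun k => ellp_cauchy_coord k FF Fc).
(* Coordinatewise convergence gives convergence in norm on each truncation. The limit [y] is not yet
   known to lie in the space. *)
have cutF K (e : R) : (0 < e)%R ->
    \forall v \near F, N (cutoff K (val v - y))%R <= e%:E.
  elim: K e => [|K IH] e e0.
    by apply: nearW => v; rewrite cutoff0 mxp_norm0// lee_fin ltW.
  have e20 : (0 < e / 2)%R by rewrite divr_gt0.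
  apply: filterS2 (IH _ e20) (yF K _ e20) => v vK vy.
  rewrite (le_trans (mxp_norm_cutoffS p1 _ _))// (splitr e) EFinD.
  exact: leeD.
(* Each truncation of $u - y$ is dominated by $(u - v)$ plus the truncation of $v - y$, whose norm
   is at most [d] for [v] far along [F]. Letting [d] tend to 0 and taking the supremum over [K]
   gives the bound. *)
have near_lim (e : R) (u : E) : (0 < e)%R ->
    (\forall v \near F, N (val u - val v)%R < e%:E) -> N (val u - y)%R <= e%:E.
  move=> e0 uF; apply: mxp_norm_cutoff_sup => // [|K].
    by rewrite lee_fin ltW.
  apply/lee_addgt0Pr => d d0; near F => v.
  apply: (@le_trans _ _ (N (val u - val v)%R + N (cutoff K (val v - y))%R)).
    apply: le_trans (mxp_normD p1 _ _) => //; apply: le_mxp_norm => // k.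
    rewrite -[X in (_ <= rnorm X)%R]/((val u k - val v k) +
      cutoff K (val v - y) k)%R.
    rewrite /cutoff; case: ifP => _; last by rewrite rnorm0 rnorm_ge0.
    by rewrite -[(val v - y)%R k]/(val v k - y k)%R subrKA.
  by apply: leeD; [apply: ltW; near: v|near: v; exact: cutF].
have [u uF] := ellp_cauchy_near FF Fc 1%R ltr01.
(* Since $y = u - (u - y)$ and $N(u - y) \leq 1$, the norm of [y] is finite. *)
have yE : y \in ellp_pred p1 M_col.
  rewrite inE /ellp_mx/= -[y](subKr (val u)).
  apply: le_lt_trans (mxp_normD p1 _ _) _ => //; rewrite mxp_normN//.
  apply: lte_add_pinfty; first exact: ellp_lty.
  exact: le_lt_trans (near_lim _ _ ltr01 uF) (ltry _).
apply/cvg_ex; exists (Ellp yE).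
(* A positive radius in [R[i]] is real, so it may be replaced by its real part. *)
apply/cvgrPdist_le => e e0; rewrite -(RRe_real (gtr0_real e0)).
have e20 : (0 < complex.Re e / 2)%R.
  by rewrite divr_gt0// -ltcR (RRe_real (gtr0_real e0)).
have [w wF] := ellp_cauchy_near FF Fc _ e20.
have wy := near_lim _ _ e20 wF; apply: filterS wF => v wv.
rewrite -rnormE lecR -lee_fin ellp_rnormE raddfB/=.
rewrite -(subrKA (val w)) (splitr (complex.Re e)) EFinD.
apply: le_trans (mxp_normD p1 _ _) _ => //.
by rewrite leeD ?(ltW wv)// mxp_normB.
Unshelve. all: by end_near. Qed.

HB.instance Definition _ := Uniform_isComplete.Build E ellp_cauchy_cvg.

(** The dense set consists of finitely supported sequences with rational real and imaginary parts,
    coded by finite lists. *)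
Lemma ellp_separable : separable E.
Proof.
pose q (c : rat * rat) : R[i] := (ratr c.1 +i* ratr c.2).
pose f (s : seq (rat * rat)) : Cseq R := fun k => nth 0%R (map q s) k.
have qdense (z : R[i]) (e : R) : (0 < e)%R -> exists c, (rnorm (z - q c) < e)%R.
  move=> e0; have e20 : (0 < e / 2)%R by rewrite divr_gt0.
  have approx (r : R) : exists c : rat, (`|r - ratr c| < e / 2)%R.
    have re : (r < r + e / 2)%R by rewrite ltrDl.
    have [c] := rat_in_itvoo re.
    rewrite in_itv/= => /andP[rc cr]; exists c.
    by rewrite distrC gtr0_norm ?subr_gt0// ltrBlDl.
  have [a az] := approx (complex.Re z); have [b bz] := approx (complex.Im z).
  exists (a, b); rewrite (le_lt_trans (rnorm_leD _))// !raddfB/= (splitr e).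
  exact: ltrD.
(* Fixing the length of [s] at [K] makes [rcons] write exactly at coordinate [K]. *)
have cutq (u : E) K (e : R) : (0 < e)%R ->
    exists2 s, size s = K & N (cutoff K (val u) - f s)%R < e%:E.
  elim: K e => [|K IH] e e0.
    have f0 : f [::] = 0%R by apply/funext => k; exact: nth_nil.
    by exists [::]; rewrite // cutoff0 f0 subr0 mxp_norm0.
  have e20 : (0 < e / 2)%R by rewrite divr_gt0.
  have [s sK us] := IH _ e20.
  have [c uc] : exists c,
      (rnorm (val u K - q c))%:E * N (unitseq K) < (e / 2)%:E.
    (* If $e_K$ has infinite norm, the coordinate is 0 and must be matched exactly; otherwise it is
       approximated within $e/(2d)$. *)
    have [dy|] := eqVneq (N (unitseq K)) +oo.
      exists (0%R, 0%R); rewrite (ellp_coord_eq0 _ _ dy) /q/= rmorph0 subr0.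
      by rewrite rnorm0 mul0e lte_fin.
    rewrite -ltey => dy; move: (mxp_norm_unitseq_gt0 p1 K (M_col K)) dy.
    case: (N (unitseq K)) => // d; rewrite lte_fin => d0 _.
    have [c uc] := qdense (val u K) _ (divr_gt0 e20 d0).
    by exists c; rewrite lte_fin -ltr_pdivlMr.
  exists (rcons s c); first by rewrite size_rcons sK.
  rewrite (splitr e) EFinD; apply: le_lt_trans (lteD us uc).
  rewrite -mxp_normZ//; apply: le_trans (mxp_normD p1 _ _) => //.
  apply: le_mxp_norm => // k.
  rewrite -[X in (rnorm X <= _)%R]/(cutoff K.+1 (val u) k - f (rcons s c) k)%R.
  rewrite -[X in (_ <= rnorm X)%R]/(cutoff K (val u) k - f s k +
    (val u K - q c) * unitseq K k)%R.
  rewrite /f map_rcons nth_rcons size_map sK /cutoff /unitseq ltnS.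
  case: (ltngtP k K) => [kK|kK|->].
  - by rewrite mulr0 addr0.
  - by rewrite subr0 rnorm0 rnorm_ge0.
  - by rewrite mulr1 nth_default ?size_map ?sK// subr0 add0r.
(* Some lists code sequences of infinite norm; [insubd] sends these to 0. *)
exists (range (fun s => insubd (0%R : E) (f s))).
  exact: card_le_trans (card_image_le _ _) (countableP _).
move=> O [u Ou] oO.
have /nbhs_ballP[e e0 eO] : nbhs u O by exact: open_nbhs_nbhs.
have eE := RRe_real (gtr0_real e0); move: e0 eO; rewrite -{}eE.
move: (complex.Re e) => {}e /=; rewrite ltcR => e0 eO.
have e20 : (0 < e / 2)%R by rewrite divr_gt0.
have [K uK] := mxp_norm_cutoff_approx p1 (val u) _ e20 (ellp_lty u).
have [s _ us] := cutq u K _ e20.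
have ue : N (val u - f s)%R < e%:E.
  rewrite -(subrKA (cutoff K (val u))) (splitr e) EFinD.
  exact: le_lt_trans (mxp_normD p1 _ _) (lteD uK us).
(* Closeness to [u] gives [f s] a finite norm, so [insubd] does not fall back on its default. *)
have fs : f s \in ellp_pred p1 M_col.
  rewrite inE /ellp_mx/= -[f s](subKr (val u)).
  apply: le_lt_trans (mxp_normD p1 _ _) _; rewrite mxp_normN//.
  apply: lte_add_pinfty; first exact: ellp_lty.
  exact: lt_trans ue (ltry _).
exists (insubd (0%R : E) (f s)); split; last by exists s.
by apply: eO; rewrite ellp_ballE insubdK.
Qed.

End ellp_complete.

Theorem theorem3p1 (R : realType) (M : nat -> nat -> R[i])
    (M_col : forall k : nat, exists n : nat, M n k <> 0%R)
    (p : R) (p_ge1 : (1 <= p)%R) :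
  separable_Banach_space (ellp_mx M p) (mxp_norm M p).
Proof.
exists (ellp_type p_ge1 M_col).
exists (val : {linear ellp_type p_ge1 M_col -> Cseq R}).
split; [exact: val_inj| | |exact: ellp_separable]; last first.
  by move=> u; rewrite ellp_rnormE.
apply/seteqP; split=> [_ [u _ <-]|x xM]; first exact: ellp_lty.
have xE : x \in ellp_pred p_ge1 M_col by rewrite inE.
by exists (Ellp xE).
Qed.
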